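(* For every $n\ge4$ there exists an $n$-dimensional vacuum static space $(M,g,f)$ satisfying $\mathrm{div}^2B=0$ and $\mathrm{div}^4\mathcal W=0$ with $B\ne0$.
   Context: Manifolds are connected. For a Riemannian manifold $(M^n,g)$, $n\ge4$, let $D$ be the Levi-Civita connection, $r$ the Ricci tensor, $s$ the scalar curvature, and $\mathcal W$ the Weyl tensor, with the curvature sign convention that $R(X,Y,X,Y)>0$ on round spheres. $\{E_i\}$ denotes a local orthonormal frame. Vacuum static space: a complete Riemannian manifold $(M^n,g)$ with a non-trivial (non-constant) smooth function $f$ satisfying $Ddf-\left(r-\frac{s}{n-1}g\right)f=0$, where $Ddf$ is the Hessian of $f$; taking the trace, $\Delta f=-\frac{s}{n-1}f$. Divergence: for a $k$-tensor $S$, $\mathrm{div}\,S(X_2,\dots,X_k)=\sum_i (D_{E_i}S)(E_i,X_2,\dots,X_k)$, and $\mathrm{div}^m$ is the $m$-fold iterate. Cotton tensor: $C=d^Dr-\frac1{2(n-1)}ds\wedge g$, where $(d^Dr)(X,Y,Z)=(D_Xr)(Y,Z)-(D_Yr)(X,Z)$ and $(\phi\wedge\eta)(X,Y,Z)=\phi(X)\eta(Y,Z)-\phi(Y)\eta(X,Z)$ for a 1-form $\phi$ and symmetric 2-tensor $\eta$. Complete divergence of $\mathcal W$: with the identification $\mathrm{div}\,\mathcal W=\frac{n-3}{n-2}C$ (i.e. $\mathrm{div}\,\mathcal W(X,Y,Z)=\frac{n-3}{n-2}C(Y,Z,X)$), one sets $\mathrm{div}^4\mathcal W=\frac{n-3}{n-2}\mathrm{div}^3C$;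 thus $\mathrm{div}^4\mathcal W=0$ means $\mathrm{div}^3C=0$. Bach tensor: $B=\frac1{n-2}\left(\mathrm{div}\,C+\mathring{\mathcal W}r\right)$, where $\mathring{\mathcal W}r(X,Y)=\sum_{i,j}\mathcal W(X,E_i,Y,E_j)\,r(E_i,E_j)$ (equivalently $B=\frac1{n-3}\mathrm{div}_1\mathrm{div}_4\mathcal W+\frac1{n-2}\mathring{\mathcal W}r$). *)

(* Defs.v *)
From HB Require Import structures.
From mathcomp Require Import all_boot all_order all_algebra.
From mathcomp Require Import all_classical all_reals all_analysis.

Set Implicit Arguments.
Unset Strict Implicit.
Unset Printing Implicit Defensive.

Import Order.TTheory GRing.Theory Num.Theory.
Import numFieldNormedType.Exports.

Local Open Scope classical_set_scope.
Local Open Scope ring_scope.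

(** Calculus on open subsets of R^n *)

Definition partial (R : realType) (n : nat) (i : 'I_n) (F : 'rV[R]_n -> R)
    (x : 'rV[R]_n) : R :=
  'D_(delta_mx 0 i) F x.

(* C^oo on the open set U: every iterated partial derivative exists and is
   continuous at every point of U. *)
Definition smooth_on (R : realType) (n : nat) (U : set 'rV[R]_n)
    (F : 'rV[R]_n -> R) : Prop :=
  forall (s : seq 'I_n) (x : 'rV[R]_n), U x ->
    {for x, continuous (foldr (@partial R n) F s)} /\
    forall i : 'I_n, derivable (foldr (@partial R n) F s) x (delta_mx 0 i).

(** Smooth manifolds, Riemannian metrics *)

(* [param i] is the inverse of the chart [chart i], which is a homeomorphism
   from the open set [dom i] onto the open set [cod i]; the values of [chart i]
   and [param i] outside [dom i] and [cod i] are irrelevant. *)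
Record smoothManifold (R : realType) (n : nat) := SmoothManifold {
  carrier :> topologicalType;
  manifold_hausdorff : hausdorff_space carrier;
  manifold_second_countable : @second_countable carrier;
  manifold_connected : connected [set: carrier];
  chart_index : Type;
  dom : chart_index -> set carrier;
  cod : chart_index -> set 'rV[R]_n;
  chart : chart_index -> carrier -> 'rV[R]_n;
  param : chart_index -> 'rV[R]_n -> carrier;
  dom_open : forall i, open (dom i);
  cod_open : forall i, open (cod i);
  dom_cover : forall p, exists i, dom i p;
  chart_cod : forall i p, dom i p -> cod i (chart i p);
  param_dom : forall i x, cod i x -> dom i (param i x);
  chartK : forall i p, dom i p -> param i (chart i p) = p;
  paramK : forall i x, cod i x -> chart i (param i x) = x;
  chart_continuous : forall i p, dom i p -> {for p, continuous (chart i)};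
  param_continuous : forall i x, cod i x -> {for x, continuous (param i)};
  transition_smooth : forall i j (k : 'I_n),
    smooth_on (cod i `&` param i @^-1` dom j)
      (fun x => chart j (param i x) 0 k)
}.

Definition smooth_function (R : realType) (n : nat) (M : smoothManifold R n)
    (f : M -> R) : Prop :=
  forall i : chart_index M, smooth_on (cod i) (f \o param i).

(* Entry (a, c) is the derivative of the c-th new coordinate along the a-th old
   one. *)
Definition transition_jac (R : realType) (n : nat) (M : smoothManifold R n)
    (i j : chart_index M) (x : 'rV[R]_n) : 'M[R]_n :=
  \matrix_(a, c) partial a (fun y => chart j (param i y) 0 c) x.

(* [gmx i x] is the Gram matrix of the coordinate frame of the chart i at the
   point [param i x]; [gmx_compat] is the transformation law of a covariant
   2-tensor. *)
Record riemannianMetric (R : realType) (n : nat) (M : smoothManifold R n) :=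
  RiemannianMetric {
  gmx :> chart_index M -> 'rV[R]_n -> 'M[R]_n;
  gmx_smooth : forall i (a b : 'I_n), smooth_on (cod i) (fun x => gmx i x a b);
  gmx_sym : forall i x, cod i x -> (gmx i x)^T = gmx i x;
  gmx_pos : forall i x, cod i x -> forall v : 'rV[R]_n, v != 0 ->
    0 < (v *m gmx i x *m v^T) 0 0;
  gmx_compat : forall i j x, cod i x -> dom j (param i x) ->
    gmx i x = transition_jac i j x *m gmx j (chart j (param i x))
                *m (transition_jac i j x)^T
}.

(** Tensor calculus in one chart, G being the matrix of the metric *)

(* Components of a covariant k-tensor field: T s x = T(d_(s_0),...,d_(s_(k-1)))
   at the point of coordinates x. *)
Definition tensor (R : realType) (n k : nat) : Type :=
  k.-tuple 'I_n -> 'rV[R]_n -> R.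

(* The sum over an orthonormal frame (E_i) of T(E_i, E_i) is the contraction of
   T with the inverse matrix of G. *)
Lemma orthonormal_frame_invmx (R : realType) (n : nat) (E G : 'M[R]_n) :
  E *m G *m E^T = 1%:M -> invmx G = E^T *m E.
Proof.
move=> EG; have EGu : E *m G *m E^T \in unitmx by rewrite EG unitmx1.
move: EGu; rewrite !unitmx_mul => /andP[/andP[_ Gu] _].
have /(congr1 (mulmx^~ (invmx G))) : E^T *m E *m G = 1%:M.
  by rewrite -mulmxA; apply: mulmx1C.
by rewrite mulmxK // mul1mx.
Qed.

Section LocalTensorCalculus.
Context {R : realType} {n : nat} (G : 'rV[R]_n -> 'M[R]_n).

Definition ginv (a b : 'I_n) (x : 'rV[R]_n) : R := invmx (G x) a b.

(* D_(d_i) d_j = \sum_k (christoffel k i j) d_k *)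
Definition christoffel (k i j : 'I_n) (x : 'rV[R]_n) : R :=
  2^-1 * \sum_m ginv k m x *
    (partial i (fun y => G y j m) x + partial j (fun y => G y i m) x
     - partial m (fun y => G y i j) x).

Definition subst_index k (s : k.-tuple 'I_n) (j : 'I_k) (m : 'I_n) :
    k.-tuple 'I_n :=
  [tuple if l == j then m else tnth s l | l < k].

(* Covariant derivative; the direction of differentiation is the first slot. *)
Definition cov_deriv k (T : tensor R n k) : tensor R n k.+1 := fun s x =>
  let i := thead s in let s' : k.-tuple 'I_n := [tuple of behead s] in
  partial i (T s') x
  - \sum_(j < k) \sum_m
      christoffel m i (tnth s' j) x * T (subst_index s' j m) x.

Definition tdiv k (T : tensor R n k.+1) : tensor R n k := fun s x =>
  \sum_a \sum_b ginv a b x * cov_deriv T [tuple of a :: b :: s] x.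

Definition scalar_tensor (F : 'rV[R]_n -> R) : tensor R n 0 := fun=> F.

Definition hessian (F : 'rV[R]_n -> R) : tensor R n 2 :=
  cov_deriv (cov_deriv (scalar_tensor F)).

(* Component on d_m of D_(d_i) D_(d_j) d_l - D_(d_j) D_(d_i) d_l. *)
Definition curvature_op (i j l m : 'I_n) (x : 'rV[R]_n) : R :=
  partial i (christoffel m j l) x - partial j (christoffel m i l) x
  + \sum_p (christoffel m i p x * christoffel p j l x
            - christoffel m j p x * christoffel p i l x).

(* R(X,Y,Z,W) = g(D_X D_Y W - D_Y D_X W - D_[X,Y] W, Z), so that R(X,Y,X,Y) is
   positive on round spheres. *)
Definition riemann (i j k l : 'I_n) (x : 'rV[R]_n) : R :=
  \sum_m G x k m * curvature_op i j l m x.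

Definition ricci : tensor R n 2 := fun s x =>
  \sum_a \sum_b ginv a b x * riemann a (tnth s 0) b (tnth s 1) x.

Definition scal (x : 'rV[R]_n) : R :=
  \sum_a \sum_b ginv a b x * ricci [tuple a; b] x.

Definition weyl (i j k l : 'I_n) (x : 'rV[R]_n) : R :=
  let g a b := G x a b in let r a b := ricci [tuple a; b] x in
  riemann i j k l x
  - (n%:R - 2)^-1
      * (r i k * g j l + r j l * g i k - r i l * g j k - r j k * g i l)
  + scal x / ((n%:R - 1) * (n%:R - 2)) * (g i k * g j l - g i l * g j k).

Definition cotton : tensor R n 3 := fun s x =>
  let i := tnth s 0 in let j := tnth s 1 in let k := tnth s 2 in
  let ds a := cov_deriv (scalar_tensor scal) [tuple a] x in
  cov_deriv ricci [tuple i; j; k] x - cov_deriv ricci [tuple j; i; k] x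
  - (2 * (n%:R - 1))^-1 * (ds i * G x j k - ds j * G x i k).

(* The paper's convention: div W is identified with (n-3)/(n-2) C. *)
Definition div4_weyl : tensor R n 0 := fun s x =>
  (n%:R - 3) / (n%:R - 2) * tdiv (tdiv (tdiv cotton)) s x.

Definition weyl_ricci : tensor R n 2 := fun s x =>
  \sum_a \sum_b \sum_c \sum_d ginv a c x * ginv b d x
    * weyl (tnth s 0) a (tnth s 1) b x * ricci [tuple c; d] x.

Definition bach : tensor R n 2 := fun s x =>
  (n%:R - 2)^-1 * (tdiv cotton s x + weyl_ricci s x).

Definition static_tensor (F : 'rV[R]_n -> R) : tensor R n 2 := fun s x =>
  hessian F s x
  - (ricci s x - scal x / (n%:R - 1) * G x (tnth s 0) (tnth s 1)) * F x.

End LocalTensorCalculus.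

(** Global notions *)

(* T gives the components of a tensor field in every chart. *)
Definition vanishes (R : realType) (n k : nat) (M : smoothManifold R n)
    (T : chart_index M -> tensor R n k) : Prop :=
  forall i x s, cod i x -> T i s x = 0.

Definition geodesic (R : realType) (n : nat) (M : smoothManifold R n)
    (g : riemannianMetric M) (c : R -> M) : Prop :=
  continuous c /\
  forall (i : chart_index M) (t : R), dom i (c t) ->
    let u (k : 'I_n) (t' : R) : R := chart i (c t') 0 k in
    forall k : 'I_n,
      [/\ derivable (u k) t 1, derivable (derive1 (u k)) t 1 &
          derive1 (derive1 (u k)) t
          + \sum_a \sum_b christoffel (g i) k a b (chart i (c t))
                          * derive1 (u a) t * derive1 (u b) t = 0].

(* Geodesic completeness: every initial point and velocity is that of a geodesic
   defined for all times. *)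
Definition complete_metric (R : realType) (n : nat) (M : smoothManifold R n)
    (g : riemannianMetric M) : Prop :=
  forall (i : chart_index M) (p : M) (v : 'rV[R]_n), dom i p ->
    exists c : R -> M, [/\ geodesic g c, c 0 = p &
      forall k : 'I_n, derive1 (fun t : R => chart i (c t) 0 k) 0 = v 0 k].

Definition vacuum_static_space (R : realType) (n : nat) (M : smoothManifold R n)
    (g : riemannianMetric M) (f : M -> R) : Prop :=
  [/\ complete_metric g,
      smooth_function f,
      (exists p q, f p <> f q) &
      vanishes (fun i => static_tensor (g i) (f \o param i))].

(* Main.v *)
Require Import Defs.
From mathcomp Require Import all_boot all_order all_algebra.
From mathcomp Require Import all_classical all_reals all_analysis.
From mathcomp Require Import ring lra.

(** The example is the Riemannian product of two real hyperbolic spaces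
    H^2 x H^(n-2), of sectional curvatures -1 and -b^2 with b^2 (n-3) = 2.

    In horospherical coordinates, a product of hyperbolic spaces is R^n with a
    diagonal metric. Every coordinate j has a root par j, the height coordinate
    of its factor; a root is its own root, and g_jj = exp(2 w_j x_(par j)) with
    w_j = 0 if j is a root, w_j = rate (par j) otherwise; the factor of root r
    has curvature -(rate r)^2. There is a single chart, and each
    Christoffel symbol is a constant or a constant multiple of some g_jj.

    The curvature operator is computed once and for all
    ([curvature_op_hyp_mx]). It follows that the Ricci tensor and the
    contraction of the Weyl tensor with it are of the form tau_i g_ij where
    tau_i depends only on the factor of i ([ricci_hyp_mx],
    [weyl_ricci_hyp_mx]). Such a tensor is parallel ([cov_deriv_iso]). So the
    Ricci tensor is parallel, the scalar curvature is constant and the Cotton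
    tensor is zero, whence div^4 W = 0; the Bach tensor is a
    constant multiple of the contraction above, is parallel, and div^2 B = 0.

    If r is a root, the Hessian of f = exp(rate r * x_r) is (rate r)^2 f g on
    the factor of r and zero on the others ([hessian_exp_coord]). Hence f solves
    the static equation when the Ricci curvature is s/(n-1) on the other factors
    and s/(n-1) + (rate r)^2 on the factor of r. With curvatures -1 and -b^2 as
    above, the Ricci curvatures are -1 and -2, s = -2(n-1), and the condition
    holds for the root of H^2. On H^2 the contraction of the Weyl tensor with
    the Ricci tensor is -g, so that B is not zero.

    The product is complete because geodesics are explicit
    ([hyperbolic_geodesic]): along a geodesic of a factor of root r, exp(rate r
    * x_r) is a nonnegative combination of exp(s t) and exp(-s t) for a
    constant s. *)

Set Implicit Arguments.
Unset Strict Implicit.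
Unset Printing Implicit Defensive.

Import Order.TTheory GRing.Theory Num.Theory.
Import numFieldNormedType.Exports.

Local Open Scope classical_set_scope.
Local Open Scope ring_scope.

(** * Topology of R^n *)

Lemma connected_rV (R : realType) (n : nat) : connected [set: 'rV[R]_n].
Proof.
(* The space is the union of the segments issued from the origin. *)
rewrite (_ : [set: 'rV[R]_n] = \bigcup_(v in [set: 'rV[R]_n])
    ((fun t : R => t *: v) @` `[0, 1])); last first.
  apply/seteqP; split=> // v _; exists v => //; exists 1; last by rewrite scale1r.
  by rewrite /= in_itv /= ler01 lexx.
apply: bigcup_connected => [|v _].
  by exists 0 => v _; exists 0; rewrite ?scale0r //= in_itv /= ler01 lexx.
apply: connected_continuous_connected; first exact: segment_connected.
by apply: continuous_subspaceT => t; exact: scalel_continuous.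
Qed.

(** The open balls with rational centre and radius 1/(k+1) form a basis. *)
Lemma second_countable_rV (R : realType) (n : nat) :
  @second_countable 'rV[R]_n.
Proof.
pose B (qk : 'rV[rat]_n * nat) : set 'rV[R]_n :=
  ball (map_mx ratr qk.1 : 'rV[R]_n) (qk.2.+1%:R^-1).
exists (range B).
  exact: sub_countable (card_image_le _ _) (countableP _).
split=> [_ [qk _ <-]|x V /nbhs_ballP[e /= e0 xeV]]; first exact: ball_open.
have [k] := @ltr_add_invr R 0 (e / 2) (divr_gt0 e0 (ltr0Sn _ _)); rewrite add0r => ke.
have k0 : 0 < k.+1%:R^-1 :> R by rewrite invr_gt0.
have /choice[q qP] : forall i : 'I_n, exists q : rat,
    `|x 0 i - ratr q| < k.+1%:R^-1.
  move=> i; have /rat_in_itvoo[q /itvP qre] : x 0 i < x 0 i + k.+1%:R^-1.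
    by rewrite ltrDl.
  exists q; rewrite distrC ltr_distl qre andbT.
  by rewrite (@le_lt_trans _ _ (x 0 i)) ?qre// lerBlDl lerDr ltW.
have Bx : ball (map_mx ratr (\row_i q i) : 'rV[R]_n) k.+1%:R^-1 x.
  split=> // i j; rewrite ord1 !mxE /ball /= distrC; exact: qP.
exists (B (\row_i q i, k)); first by split=> //; exists (\row_i q i, k).
move=> y By; apply: xeV; rewrite [e]splitr.
apply: (@ball_triangle R 'rV[R]_n (map_mx ratr (\row_i q i))).
  by apply: (le_ball (ltW ke)); exact: ball_sym.
exact: (le_ball (ltW ke)).
Qed.

(** * Smooth functions of one coordinate *)

Section OneCoordinate.
Context {R : realType} {n : nat}.

(** The difference quotients of y |-> phi (y_p) along a coordinate vector are
    those of phi, or zero. *)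
Lemma is_derive_coord (phi dphi : R -> R) (p i : 'I_n) (x : 'rV[R]_n) :
  (forall t : R, is_derive t 1 phi (dphi t)) ->
  is_derive x (delta_mx 0 i) (fun y => phi (y 0 p)) ((i == p)%:R * dphi (x 0 p)).
Proof.
move=> phiP.
have [<-{p}|ip] := eqVneq i p; last first.
  have E : (fun h : R => h^-1 *: (((fun y : 'rV[R]_n => phi (y 0 p)) \o shift x)
      (h *: delta_mx 0 i) - phi (x 0 p))) = cst 0.
    apply/funext => h /=.
    by rewrite !mxE eqxx /= [p == i]eq_sym (negbTE ip) mulr0 add0r subrr scaler0.
  rewrite mul0r; split; first by rewrite /derivable E; exact: is_cvg_cst.
  by rewrite /derive E lim_cst.
have E : (fun h : R => h^-1 *: (((fun y : 'rV[R]_n => phi (y 0 i)) \o shift x)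
    (h *: delta_mx 0 i) - phi (x 0 i))) =
    (fun h : R => h^-1 *: ((phi \o shift (x 0 i)) (h *: 1) - phi (x 0 i))).
  by apply/funext => h /=; rewrite !mxE !eqxx /=.
have [d1 d2] := phiP (x 0 i).
rewrite mul1r; split; first by rewrite /derivable E.
by rewrite /derive E.
Qed.

Lemma continuous_coord (phi dphi : R -> R) (p : 'I_n) :
  (forall t : R, is_derive t 1 phi (dphi t)) ->
  continuous (fun y : 'rV[R]_n => phi (y 0 p)).
Proof.
move=> phiP x.
apply: (@continuous_comp _ _ _ (fun y : 'rV[R]_n => y 0 p) phi).
  exact: coord_continuous.
apply: differentiable_continuous; apply/derivable1_diffP.
by have [] := phiP (x 0 p).
Qed.

(** Smoothness by coinduction: it suffices to exhibit a class of continuous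
    functions with partial derivatives in the class. *)
Lemma smooth_on_closed (S : set ('rV[R]_n -> R)) (U : set 'rV[R]_n) F :
  S F ->
  (forall f, S f -> continuous f) ->
  (forall f i x, S f -> derivable f x (delta_mx 0 i)) ->
  (forall f i, S f -> S (partial i f)) ->
  smooth_on U F.
Proof.
move=> SF Sc Sd Sp s x _.
have SFs : S (foldr (@partial R n) F s) by elim: s => //= i s; exact: Sp.
by split=> [|i]; [exact: Sc|exact: Sd].
Qed.

(** The function x |-> c exp(k x_p). Entries of the metrics considered below,
    their Christoffel symbols up to an additive constant, and the static
    potential are of this form. *)
Definition exp_coord (c k : R) (p : 'I_n) (x : 'rV[R]_n) : R :=
  c * expR (k * x 0 p).

Lemma is_derive_expM (c k t : R) :
  is_derive t 1 (fun t => c * expR (k * t)) (c * (expR (k * t) * k)).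
Proof.
have h : is_derive t 1 (fun t => k * t) k.
  by apply: is_derive_eq; rewrite /GRing.scale/= mulr1.
exact: (@is_deriveZ _ _ _ _ c).
Qed.

Lemma is_derive_exp_coord c k p (i : 'I_n) x :
  is_derive x (delta_mx 0 i) (exp_coord c k p)
    ((i == p)%:R * k * exp_coord c k p x).
Proof.
apply: is_derive_eq (is_derive_coord p i x (is_derive_expM c k)) _.
by rewrite /exp_coord; ring.
Qed.

Lemma partial_exp_coord c k p (i : 'I_n) x :
  partial i (exp_coord c k p) x = (i == p)%:R * k * exp_coord c k p x.
Proof. by have [_] := is_derive_exp_coord c k p i x. Qed.

Lemma smooth_exp_coord c k p U : smooth_on U (exp_coord c k p).
Proof.
apply: (@smooth_on_closed [set f | exists c, f = exp_coord c k p]).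
- by exists c.
- by move=> _ [d ->]; exact: continuous_coord (is_derive_expM d k).
- by move=> _ i x [d ->]; have [] := is_derive_exp_coord d k p i x.
- move=> _ i [d ->]; exists ((i == p)%:R * k * d); apply/funext => x.
  by rewrite partial_exp_coord /exp_coord mulrA.
Qed.

Lemma partial_coord (p i : 'I_n) (x : 'rV[R]_n) :
  partial i (fun y => y 0 p) x = (i == p)%:R.
Proof.
have [_] := @is_derive_coord id (cst 1) p i x (fun t => is_derive_id t 1).
by rewrite mulr1.
Qed.

Lemma smooth_coord (p : 'I_n) U : smooth_on U (fun x : 'rV[R]_n => x 0 p).
Proof.
have D c d (t : R) : is_derive t 1 (fun t => c + d * t) (cst d t).
  have h : is_derive t 1 (fun t => d * t) d.
    by apply: is_derive_eq; rewrite /GRing.scale/= mulr1.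
  by apply: is_derive_eq (is_deriveD (is_derive_cst c t 1) h) _; rewrite add0r.
apply: (@smooth_on_closed
  [set f | exists c d, f = fun x : 'rV[R]_n => c + d * x 0 p]).
- by exists 0, 1; apply/funext => x; rewrite add0r mul1r.
- by move=> _ [c [d ->]]; exact: continuous_coord (D c d).
- by move=> _ i x [c [d ->]]; have [] := is_derive_coord p i x (D c d).
- move=> _ i [c [d ->]]; exists ((i == p)%:R * d), 0; apply/funext => x.
  have [_] := is_derive_coord p i x (D c d); rewrite /partial => ->.
  by rewrite mul0r addr0.
Qed.

End OneCoordinate.

(** * Kronecker symbols, covariant derivatives of tensors of low rank *)

Lemma sum_kron (R : pzRingType) (I : finType) (k : I) (F : I -> R) :
  \sum_m (k == m)%:R * F m = F k.
Proof.
rewrite (bigD1 k) //= eqxx mul1r big1 ?addr0 // => m mk.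
by rewrite eq_sym (negbTE mk) mul0r.
Qed.

Lemma kronM (R : pzRingType) (I : eqType) (a b : I) (F : I -> R) :
  (a == b)%:R * F a = (a == b)%:R * F b.
Proof. by case: eqP => [->//|_]; rewrite !mul0r. Qed.

Lemma cov_deriv0E (R : realType) (n : nat) (G : 'rV[R]_n -> 'M[R]_n) F
    (s : 1.-tuple 'I_n) x :
  cov_deriv G (scalar_tensor F) s x = partial (tnth s 0) F x.
Proof.
by rewrite /cov_deriv big_ord0 subr0.
Qed.

Lemma cov_deriv1E (R : realType) (n : nat) (G : 'rV[R]_n -> 'M[R]_n)
    (F : 'I_n -> 'rV[R]_n -> R) (s : 2.-tuple 'I_n) x :
  cov_deriv G (fun (t : 1.-tuple 'I_n) y => F (tnth t 0) y) s x =
  partial (tnth s 0) (F (tnth s 1)) x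
  - \sum_m christoffel G m (tnth s 0) (tnth s 1) x * F m x.
Proof.
case/tupleP: s => i s; case/tupleP: s => a s.
rewrite /cov_deriv big_ord_recl big_ord0 addr0; congr (_ - _).
by apply: eq_bigr => m _; rewrite tnth_mktuple.
Qed.

Lemma cov_deriv2E (R : realType) (n : nat) (G : 'rV[R]_n -> 'M[R]_n)
    (F : 'I_n -> 'I_n -> 'rV[R]_n -> R) (s : 3.-tuple 'I_n) x :
  let i := tnth s 0 in let a := tnth s 1 in let b := tnth s 2 in
  cov_deriv G (fun (t : 2.-tuple 'I_n) y => F (tnth t 0) (tnth t 1) y) s x =
  partial i (F a b) x
  - (\sum_m christoffel G m i a x * F m b x +
     \sum_m christoffel G m i b x * F a m x).
Proof.
case/tupleP: s => i s; case/tupleP: s => a s; case/tupleP: s => b s /=.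
rewrite /cov_deriv !big_ord_recl big_ord0 addr0; congr (_ - (_ + _)).
  by apply: eq_bigr => m _; rewrite !tnth_mktuple.
by apply: eq_bigr => m _; rewrite !tnth_mktuple.
Qed.

Lemma cov_deriv_eq0 (R : realType) (n k : nat) (G : 'rV[R]_n -> 'M[R]_n) :
  cov_deriv G (fun _ _ => 0 : R) = (fun _ _ => 0) :> tensor R n k.+1.
Proof.
apply/funext => s; apply/funext => x; rewrite /cov_deriv /partial derive_cst.
by rewrite big1 ?subr0 // => j _; rewrite big1 // => m _; rewrite mulr0.
Qed.

Lemma tdiv_parallel (R : realType) (n k : nat) (G : 'rV[R]_n -> 'M[R]_n)
    (T : tensor R n k.+1) :
  cov_deriv G T = (fun _ _ => 0) -> tdiv G T = (fun _ _ => 0).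
Proof.
move=> T0; apply/funext => s; apply/funext => x; rewrite /tdiv T0.
by rewrite big1 // => a _; rewrite big1 // => b _; rewrite mulr0.
Qed.

Lemma tdiv_eq0 (R : realType) (n k : nat) (G : 'rV[R]_n -> 'M[R]_n) :
  tdiv G (fun _ _ => 0 : R) = (fun _ _ => 0) :> tensor R n k.
Proof. exact/tdiv_parallel/cov_deriv_eq0. Qed.

(** * Curvature of a product of real hyperbolic spaces *)

Section HyperbolicProduct.
Context {R : realType} {n : nat}.
(* [par j] is the root of j, that is, the height coordinate of the factor
   containing the coordinate j; [- rate r ^+ 2] is the curvature of the factor
   of root r, the values of [rate] outside the roots being irrelevant. *)
Context (par : 'I_n -> 'I_n) (rate : 'I_n -> R).
Context (par_idem : forall j, par (par j) = par j).

(** Half the logarithmic derivative of g_jj along its root. *)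
Definition weight (j : 'I_n) : R := if par j == j then 0 else rate (par j).

(** The function g_jj, the squared length of the j-th coordinate vector. *)
Definition sqlen (j : 'I_n) : 'rV[R]_n -> R :=
  exp_coord 1 (2 * weight j) (par j).

(** Gram matrix of the coordinate frame. *)
Definition hyp_mx (x : 'rV[R]_n) : 'M[R]_n := diag_mx (\row_j sqlen j x).

(** Half the logarithmic derivative of g_jj in the direction i. *)
Definition slope (i j : 'I_n) : R := (i == par j)%:R * weight j.

Lemma weight_par j : weight (par j) = 0.
Proof. by rewrite /weight par_idem eqxx. Qed.

(** The length of the coordinate vector of a root is constant. *)
Lemma slopeM0 i j k : slope i j * slope j k = 0.
Proof.
rewrite /slope; case: (j =P par k) => [->|_]; last by rewrite mul0r mulr0.
by rewrite weight_par mulr0 mul0r.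
Qed.

Lemma slopeMr i j k : slope i k * slope j k = (i == j)%:R * slope i k ^+ 2.
Proof.
have [->|ij] := eqVneq i j; first by rewrite mul1r expr2.
rewrite /slope mul0r; have [E|_] := eqVneq i (par k); last by rewrite !mul0r.
by rewrite -E eq_sym (negbTE ij) mul0r mulr0.
Qed.

Lemma sqlen_gt0 j x : 0 < sqlen j x.
Proof. by rewrite /sqlen /exp_coord mul1r expR_gt0. Qed.

Lemma sqlen_neq0 j x : sqlen j x != 0.
Proof. by rewrite gt_eqF ?sqlen_gt0. Qed.

(** If i is a root, then g_ii = 1. *)
Lemma slope_sqlen i j x : slope i j * sqlen i x = slope i j.
Proof.
rewrite /slope; case: (i =P par j) => [->|_]; last by rewrite !mul0r.
by rewrite /sqlen /exp_coord weight_par mulr0 mul0r expR0 !mulr1.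
Qed.

Lemma slope_sqlenV i j x : slope i j / sqlen i x = slope i j.
Proof. by rewrite -{1}(slope_sqlen i j x) mulfK // sqlen_neq0. Qed.

Lemma hyp_mxE a b x : hyp_mx x a b = (a == b)%:R * sqlen a x.
Proof. by rewrite !mxE; case: eqP => [->|_]; rewrite ?mul1r ?mul0r. Qed.

Lemma hyp_mxE_exp a b :
  (fun x => hyp_mx x a b) = exp_coord (a == b)%:R (2 * weight a) (par a).
Proof. by apply/funext => x; rewrite hyp_mxE /sqlen /exp_coord mul1r. Qed.

Lemma partial_hyp_mx c a b x :
  partial c (fun y => hyp_mx y a b) x = 2 * slope c a * hyp_mx x a b.
Proof.
rewrite hyp_mxE_exp partial_exp_coord -hyp_mxE_exp /slope; ring.
Qed.

Lemma ginv_hyp_mx a b x : ginv hyp_mx a b x = (a == b)%:R / sqlen a x.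
Proof.
rewrite /ginv; suff -> : invmx (hyp_mx x) = diag_mx (\row_j (sqlen j x)^-1).
  by rewrite !mxE; case: eqP => [->|_]; rewrite ?mul1r ?mul0r.
have E : diag_mx (\row_j (sqlen j x)^-1) *m hyp_mx x = 1%:M.
  rewrite mulmx_diag; apply/matrixP => i j; rewrite !mxE.
  by case: eqP => // _; rewrite mulVf ?sqlen_neq0.
have [_ u] := mulmx1_unit E.
by rewrite -[RHS]mulmx1 -(mulmxV u) mulmxA E mul1mx.
Qed.

Lemma sum_ginv k (F : 'I_n -> R) x :
  \sum_m ginv hyp_mx k m x * F m = (sqlen k x)^-1 * F k.
Proof.
rewrite -(sum_kron k (fun m => (sqlen k x)^-1 * F m)).
by apply: eq_bigr => m _; rewrite ginv_hyp_mx mulrA.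
Qed.

Lemma christoffel_hyp_mx k i j x :
  christoffel hyp_mx k i j x =
    (j == k)%:R * slope i k + (i == k)%:R * slope j k
    - (i == j)%:R * slope k i * sqlen i x.
Proof.
rewrite /christoffel.
rewrite sum_ginv !partial_hyp_mx !hyp_mxE.
rewrite -[in RHS](slope_sqlenV k i x).
have hk := sqlen_neq0 k x.
by case: (j =P k) => [->|_]; case: (i =P k) => [->|_] /=; field; exact: hk.
Qed.

Lemma sum_slope i (F : 'I_n -> R) : \sum_p slope p i * F p = weight i * F (par i).
Proof.
rewrite -(sum_kron (par i) (fun p => weight i * F p)).
by apply: eq_bigr => p _; rewrite /slope [p == _]eq_sym mulrA.
Qed.

Lemma sum_christoffel m i (F : 'I_n -> R) x :
  \sum_p christoffel hyp_mx m i p x * F p =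
    slope i m * F m + (i == m)%:R * weight i * F (par i)
    - slope m i * sqlen i x * F i.
Proof.
under eq_bigr => p _.
  rewrite christoffel_hyp_mx [p == m]eq_sym.
  rewrite (_ : _ * F p = (m == p)%:R * (slope i m * F p)
    + ((i == m)%:R * (slope p m * F p) - (i == p)%:R * (slope m i * sqlen i x * F p)));
    last by ring.
  over.
rewrite big_split sumrB /= !sum_kron -mulr_sumr sum_slope addrA.
by rewrite -(kronM i m (fun j => weight j * F (par j))) mulrA.

Qed.


Lemma partial_christoffel m i j l x :
  partial i (christoffel hyp_mx m j l) x =
    - 2 * (j == l)%:R * (slope m j * slope i j) * sqlen j x.
Proof.
set c := (l == m)%:R * slope j m + (j == m)%:R * slope l m.
rewrite (_ : christoffel _ _ _ _ =
    cst c + exp_coord (- ((j == l)%:R * slope m j)) (2 * weight j) (par j)).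
  have [_] := is_deriveD (is_derive_cst c x (delta_mx 0 i))
    (is_derive_exp_coord (- ((j == l)%:R * slope m j)) (2 * weight j) (par j) i x).
  by rewrite /partial => ->; rewrite /slope /sqlen /exp_coord; ring.
apply/funext => y; rewrite christoffel_hyp_mx /sqlen /exp_coord.
by rewrite !fctE /c; ring.
Qed.

(** For i != j, the opposite of the sectional curvature of the plane of the i-th
    and j-th coordinate vectors. For i = j, the value is the squared rate of the
    factor, so that [sect i j] depends only on the factors of i and j. *)
Definition sect (i j : 'I_n) : R := (par i == par j)%:R * rate (par i) ^+ 2.

Lemma sectE i j : i != j -> sect i j =
  slope i j ^+ 2 + slope j i ^+ 2 + (par i == par j)%:R * weight i * weight j.
Proof.
rewrite /sect /slope /weight => ij.
have [E|pij] := eqVneq (par i) (par j).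
  rewrite -E; have [Ei|] := eqVneq (par i) i; have [Ej|] := eqVneq (par i) j.
  - by rewrite -Ej Ei eqxx in ij.
  - by move=> _ /=; ring.
  - by move=> _ /=; ring.
  - by move=> _ _ /=; ring.
have [Ei|_] := eqVneq (par i) i; have [Ej|_] := eqVneq (par j) j; rewrite /=; try ring.
- have -> : (i == par j) = false by rewrite -Ei (negbTE pij).
  by rewrite /=; ring.
- have -> : (j == par i) = false by rewrite -Ej eq_sym (negbTE pij).
  by rewrite /=; ring.
- have -> : (i == par j) = false.
    by apply/eqP => Ei; move: pij; rewrite {1}Ei par_idem eqxx.
  have -> : (j == par i) = false.
    by apply/eqP => Ej; move: pij; rewrite {1}Ej par_idem eqxx.
  by rewrite /=; ring.
Qed.

(** The height component of D_j d_l is a multiple of g_jl: horospheres are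
    umbilical. *)
Lemma christoffel_par i j l x :
  weight i * christoffel hyp_mx (par i) j l x =
  - (j == l)%:R * ((par i == par j)%:R * weight i * weight j) * sqlen j x.
Proof.
by rewrite christoffel_hyp_mx {1 2 3}/slope !weight_par; ring.
Qed.

(** The quadratic term of the curvature operator. *)
Lemma sum_christoffel2 i j l m x : i != j ->
  \sum_p christoffel hyp_mx m i p x * christoffel hyp_mx p j l x =
    (j == m)%:R * (i == l)%:R * slope i j ^+ 2
    - (i == m)%:R * (j == l)%:R * ((par i == par j)%:R * weight i * weight j) * sqlen j x
    - (i == l)%:R * (j == m)%:R * slope j i ^+ 2 * sqlen i x.
Proof.
move=> ij; rewrite sum_christoffel -[_ * weight i * _]mulrA christoffel_par.
rewrite !christoffel_hyp_mx.
have h1 : slope i m * slope j m = 0 by rewrite slopeMr (negbTE ij) mul0r.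
have h2 : slope i m * ((j == m)%:R * slope l m) =
    (j == m)%:R * (i == l)%:R * slope i j ^+ 2.
  rewrite mulrCA slopeMr mulrA -mulrA -(kronM j m (fun k => _ * slope i k ^+ 2)).
  by rewrite mulrA.
have h3 := slopeM0 i m j.
have h4 : slope m i * ((l == i)%:R * slope j i) =
    (i == l)%:R * (j == m)%:R * slope j i ^+ 2.
  by rewrite mulrCA [slope m i * _]mulrC slopeMr mulrA [l == i]eq_sym.
have h5 := slopeM0 m i j.
rewrite [j == i]eq_sym (negbTE ij).
have -> : slope i m * ((l == m)%:R * slope j m + (j == m)%:R * slope l m
    - (j == l)%:R * slope m j * sqlen j x) =
  (l == m)%:R * (slope i m * slope j m) + slope i m * ((j == m)%:R * slope l m)
    - (j == l)%:R * (slope i m * slope m j) * sqlen j x by ring.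
have -> : slope m i * sqlen i x * ((l == i)%:R * slope j i + false%:R * slope l i
    - (j == l)%:R * slope i j * sqlen j x) =
  slope m i * ((l == i)%:R * slope j i) * sqlen i x
    - (j == l)%:R * (slope m i * slope i j) * sqlen i x * sqlen j x by rewrite /=; ring.
by rewrite h1 h2 h3 h4 h5; ring.
Qed.

Lemma curvature_op_hyp_mx i j l m x :
  curvature_op hyp_mx i j l m x =
  - sect i j * ((i == m)%:R * (j == l)%:R * sqlen j x
                - (j == m)%:R * (i == l)%:R * sqlen i x).
Proof.
rewrite /curvature_op sumrB !partial_christoffel.
have [->|ij] := eqVneq i j; first by ring.
have ji : j != i by rewrite eq_sym.
rewrite !sum_christoffel2 // sectE //.
rewrite [slope m j * _]mulrC [slope m i * _]mulrC !slopeMr.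
have h1 := slope_sqlen i j x.
have h2 := slope_sqlen j i x.
have -> : (j == m)%:R * (i == l)%:R * slope i j ^+ 2 =
   (j == m)%:R * (i == l)%:R * slope i j * (slope i j * sqlen i x) by rewrite h1; ring.
have -> : (i == m)%:R * (j == l)%:R * slope j i ^+ 2 =
   (i == m)%:R * (j == l)%:R * slope j i * (slope j i * sqlen j x) by rewrite h2; ring.
by rewrite [par j == par i]eq_sym; ring.
Qed.

(** The 2-tensor tau_i g_ij, a multiple of the metric on each factor when tau is
    constant on the factors. *)
Definition iso_tensor (tau : 'I_n -> R) : tensor R n 2 := fun s x =>
  (tnth s 0 == tnth s 1)%:R * tau (tnth s 0) * sqlen (tnth s 0) x.

Lemma partial_iso (tau : 'I_n -> R) c a b x :
  partial c (fun y => (a == b)%:R * tau a * sqlen a y) x =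
  (a == b)%:R * tau a * (2 * slope c a) * sqlen a x.
Proof.
rewrite (_ : (fun _ => _) = exp_coord ((a == b)%:R * tau a) (2 * weight a) (par a)).
  by rewrite partial_exp_coord /slope /sqlen /exp_coord; ring.
by apply/funext => y; rewrite /sqlen /exp_coord mul1r.
Qed.

Lemma cov_deriv_iso (tau : 'I_n -> R) :
  (forall i j, par i = par j -> tau i = tau j) ->
  cov_deriv hyp_mx (iso_tensor tau) = fun _ _ => 0.
Proof.
move=> tauP; apply/funext => s; apply/funext => x.
have slope_tau i j : slope i j * tau i = slope i j * tau j.
  rewrite /slope; case: eqP => [->|_]; last by rewrite !mul0r.
  by rewrite (tauP (par j) j) ?par_idem.
rewrite (cov_deriv2E _ (fun a b y => (a == b)%:R * tau a * sqlen a y)) partial_iso.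
move: (tnth s 0) (tnth s 1) (tnth s 2) => i a b.
have -> : \sum_m christoffel hyp_mx m i a x * ((m == b)%:R * tau m * sqlen m x) =
    christoffel hyp_mx b i a x * (tau b * sqlen b x).
  rewrite -(sum_kron b (fun m => christoffel hyp_mx m i a x * (tau m * sqlen m x))).
  by apply: eq_bigr => m _; rewrite [m == b]eq_sym; ring.
have -> : \sum_m christoffel hyp_mx m i b x * ((a == m)%:R * tau a * sqlen a x) =
    christoffel hyp_mx a i b x * (tau a * sqlen a x).
  rewrite -(sum_kron a (fun m => christoffel hyp_mx m i b x * (tau a * sqlen a x))).
  by apply: eq_bigr => m _; ring.
rewrite !christoffel_hyp_mx.
have hab := slope_sqlen b i x; have haa := slope_sqlen a i x.
have tb := slope_tau b i; have ta := slope_tau a i.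
have tb' := slope_tau i b; have ta' := slope_tau i a.
have -> : ((a == b)%:R * slope i b + (i == b)%:R * slope a b
    - (i == a)%:R * slope b i * sqlen i x) * (tau b * sqlen b x) =
  (a == b)%:R * slope i a * tau a * sqlen a x
    + (i == b)%:R * (slope a i * tau a) * sqlen i x
    - (i == a)%:R * (slope b i * tau b) * sqlen i x.
  (* slope a i vanishes unless a and i are in the same factor, and tau is constant
     on the factors. *)
  rewrite -[in RHS]hab.
  have -> : (a == b)%:R * slope i a * tau a * sqlen a x =
     (a == b)%:R * slope i b * tau b * sqlen b x by case: eqP => [->//|_]; rewrite !mul0r.
  have -> : (i == b)%:R * (slope a i * tau a) * sqlen i x =
     (i == b)%:R * slope a b * tau b * sqlen b x.
    by rewrite ta; case: eqP => [->|_] /=; ring.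
  by ring.
have -> : ((b == a)%:R * slope i a + (i == a)%:R * slope b a
    - (i == b)%:R * slope a i * sqlen i x) * (tau a * sqlen a x) =
  (a == b)%:R * slope i a * tau a * sqlen a x
    + (i == a)%:R * (slope b i * tau b) * sqlen i x
    - (i == b)%:R * (slope a i * tau a) * sqlen i x.
  rewrite -[in RHS]haa [b == a]eq_sym.
  have -> : (i == a)%:R * (slope b i * tau b) * sqlen i x =
     (i == a)%:R * slope b a * tau a * sqlen a x.
    by rewrite tb; case: eqP => [->|_] /=; ring.
  by ring.
by ring.
Qed.

Lemma riemann_hyp_mx i j k l x :
  riemann hyp_mx i j k l x = sqlen k x * curvature_op hyp_mx i j l k x.
Proof.
rewrite -(sum_kron k (fun m => sqlen k x * curvature_op hyp_mx i j l m x)).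
by apply: eq_bigr => m _; rewrite hyp_mxE -mulrA.
Qed.

(** Ricci curvature in the direction i, that is, minus the sum of [sect i a] over
    a != i. *)
Definition ric_coef (i : 'I_n) : R := rate (par i) ^+ 2 - \sum_a sect i a.

Lemma ric_coef_par i j : par i = par j -> ric_coef i = ric_coef j.
Proof. by rewrite /ric_coef /sect => ->. Qed.

Lemma ricci_hyp_mx : ricci hyp_mx = iso_tensor ric_coef.
Proof.
apply/funext => s; apply/funext => x; rewrite /ricci /iso_tensor.
move: (tnth s 0) (tnth s 1) => i j.
under eq_bigr => a _.
  rewrite sum_ginv riemann_hyp_mx mulKf ?sqlen_neq0 // curvature_op_hyp_mx eqxx.
  have -> : sect a i = sect i a.
    by rewrite /sect eq_sym; case: eqP => [->//|_]; rewrite !mul0r.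
  rewrite (_ : - sect i a * _ = (i == a)%:R * (sect i a * (a == j)%:R * sqlen a x)
    - (i == j)%:R * sqlen i x * sect i a); last by rewrite /=; ring.
  over.
rewrite sumrB sum_kron -mulr_sumr /ric_coef /sect eqxx /=; ring.
Qed.

Lemma scal_hyp_mx : scal hyp_mx = cst (\sum_a ric_coef a).
Proof.
apply/funext => x; rewrite /scal ricci_hyp_mx; apply: eq_bigr => a _.
rewrite sum_ginv /iso_tensor /= /tnth /= eqxx mul1r mulrCA.
by rewrite mulVf ?mulr1 ?sqlen_neq0.
Qed.

Lemma cov_deriv_scal s x :
  cov_deriv hyp_mx (scalar_tensor (scal hyp_mx)) s x = 0.
Proof. by rewrite cov_deriv0E scal_hyp_mx /partial derive_cst. Qed.

Lemma cotton_hyp_mx : cotton hyp_mx = fun _ _ => 0.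
Proof.
apply/funext => s; apply/funext => x.
rewrite /cotton !cov_deriv_scal ricci_hyp_mx !cov_deriv_iso; last exact: ric_coef_par.
by rewrite !mul0r !subr0 mulr0 subr0.
Qed.

(** For a != i, the Weyl curvature of the plane of the i-th and a-th coordinate
    vectors; for a = i, the value given by the same formula. *)
Definition weyl_coef (i a : 'I_n) : R :=
  - sect i a - (ric_coef i + ric_coef a) / (n%:R - 2)
  + (\sum_b ric_coef b) / ((n%:R - 1) * (n%:R - 2)).

Lemma weyl_hyp_mx i a j x : weyl hyp_mx i a j a x =
  (i == j)%:R * (1 - (i == a)%:R) * weyl_coef i a * sqlen i x * sqlen a x.
Proof.
rewrite /weyl riemann_hyp_mx curvature_op_hyp_mx scal_hyp_mx ricci_hyp_mx.
rewrite !hyp_mxE /iso_tensor /tnth /= eqxx /weyl_coef.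
by case: (i =P a) => [<-|_]; case: (i =P j) => [<-|_] /=; ring.
Qed.

(** Coefficient of the contraction of the Weyl and Ricci tensors, that is, the sum
    of [ric_coef a * weyl_coef i a] over a != i; written so that it visibly
    depends only on the factor of i. *)
Definition weyl_ric_coef (i : 'I_n) : R :=
  \sum_a ric_coef a * weyl_coef i a - ric_coef i * weyl_coef i i.

Lemma weyl_ricci_hyp_mx : weyl_ricci hyp_mx = iso_tensor weyl_ric_coef.
Proof.
apply/funext => s; apply/funext => x; rewrite /weyl_ricci [in RHS]/iso_tensor.
move: (tnth s 0) (tnth s 1) => i j.
transitivity (\sum_a ((i == j)%:R * sqlen i x) *
   (ric_coef a * weyl_coef i a - (i == a)%:R * (ric_coef a * weyl_coef i a))).
  apply: eq_bigr => a _.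
  have ga := sqlen_neq0 a x.
  transitivity (\sum_b (a == b)%:R * ((sqlen a x)^-1 * (sqlen b x)^-1 *
      weyl hyp_mx i a j b x * ric_coef a * sqlen a x)).
    apply: eq_bigr => b _.
    transitivity (\sum_c ginv hyp_mx a c x * ((sqlen b x)^-1 *
        (weyl hyp_mx i a j b x * ricci hyp_mx [tuple c; b] x))).
      apply: eq_bigr => c _.
      rewrite -(sum_ginv b (fun d => weyl hyp_mx i a j b x *
        ricci hyp_mx [tuple c; d] x)) mulr_sumr.
      by apply: eq_bigr => d _; ring.
    by rewrite sum_ginv ricci_hyp_mx /iso_tensor /tnth /=; ring.
  rewrite sum_kron weyl_hyp_mx.
  have [/eqP ->|ij] := boolP (i == j).
    by field.
  by rewrite /=; field.
by rewrite -mulr_sumr sumrB sum_kron /weyl_ric_coef; ring.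
Qed.

Lemma weyl_ric_coef_par i j : par i = par j -> weyl_ric_coef i = weyl_ric_coef j.
Proof.
by move=> E; rewrite /weyl_ric_coef /weyl_coef (ric_coef_par E) /sect E !eqxx.
Qed.

Lemma bach_hyp_mx :
  bach hyp_mx = iso_tensor (fun i => (n%:R - 2)^-1 * weyl_ric_coef i).
Proof.
apply/funext => s; apply/funext => x.
rewrite /bach cotton_hyp_mx tdiv_eq0 weyl_ricci_hyp_mx /iso_tensor; ring.
Qed.

Lemma tdiv2_bach : tdiv hyp_mx (tdiv hyp_mx (bach hyp_mx)) = fun _ _ => 0.
Proof.
rewrite bach_hyp_mx (@tdiv_parallel _ _ _ _ (iso_tensor _)) ?tdiv_eq0 //.
by apply: cov_deriv_iso => i j /weyl_ric_coef_par ->.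
Qed.

Lemma div4_weyl_hyp_mx : div4_weyl hyp_mx = fun _ _ => 0.
Proof.
apply/funext => s; apply/funext => x.
by rewrite /div4_weyl cotton_hyp_mx !tdiv_eq0 mulr0.
Qed.

Lemma bach_diag_neq0 i x : n%:R - 2 != 0 :> R -> weyl_ric_coef i != 0 ->
  bach hyp_mx [tuple i; i] x != 0.
Proof.
move=> n2 wi; rewrite bach_hyp_mx /iso_tensor /tnth /= eqxx mul1r.
apply: mulf_neq0; last exact: sqlen_neq0.
by apply: mulf_neq0 => //; rewrite invr_neq0.
Qed.

(** The height exponential of a factor: its Hessian is a multiple of the metric of
    that factor. *)
Lemma hessian_exp_coord r s x : par r = r ->
  hessian hyp_mx (exp_coord 1 (rate r) r) s x =
  (par (tnth s 0) == r)%:R * rate r ^+ 2 * hyp_mx x (tnth s 0) (tnth s 1)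
  * exp_coord 1 (rate r) r x.
Proof.
move=> rr; rewrite /hessian.
have -> : cov_deriv hyp_mx (scalar_tensor (exp_coord 1 (rate r) r)) =
    fun (t : 1.-tuple 'I_n) => exp_coord ((tnth t 0 == r)%:R * rate r) (rate r) r.
  apply/funext => t; apply/funext => y.
  by rewrite cov_deriv0E partial_exp_coord /exp_coord mul1r.
rewrite (cov_deriv1E _ (fun i => exp_coord ((i == r)%:R * rate r) (rate r) r)).
move: (tnth s 0) (tnth s 1) => i j.
rewrite partial_exp_coord.
have -> : \sum_m christoffel hyp_mx m i j x * exp_coord ((m == r)%:R * rate r) (rate r) r x =
    christoffel hyp_mx r i j x * exp_coord (rate r) (rate r) r x.
  rewrite -(sum_kron r (fun m => christoffel hyp_mx m i j x *
    exp_coord (rate r) (rate r) r x)).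
  by apply: eq_bigr => m _; rewrite [m == r]eq_sym /exp_coord; ring.
have sr k : slope k r = 0 by rewrite /slope -{2}rr weight_par mulr0.
rewrite christoffel_hyp_mx !sr hyp_mxE /exp_coord.
have -> : (i == j)%:R * slope r i * sqlen i x =
   (i == j)%:R * (par i == r)%:R * (1 - (i == r)%:R) * rate r * sqlen i x.
  congr (_ * _); rewrite -!mulrA; congr (_ * _).
  rewrite /slope eq_sym /weight; have [pr|_] := eqVneq (par i) r; last by rewrite !mul0r.
  by rewrite pr [r == i]eq_sym; case: eqP => _ /=; ring.
have [->|ir] := eqVneq i r; last by rewrite /=; ring.
have gr : sqlen r x = 1.
  by rewrite /sqlen /exp_coord -{1}rr weight_par mulr0 mul0r expR0 mulr1.
rewrite rr eqxx gr [r == j]eq_sym /=; ring.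
Qed.

Lemma static_exp_coord r s x : par r = r ->
  (forall i, (par i == r)%:R * rate r ^+ 2 =
     ric_coef i - (\sum_a ric_coef a) / (n%:R - 1)) ->
  static_tensor hyp_mx (exp_coord 1 (rate r) r) s x = 0.
Proof.
move=> rr E; rewrite /static_tensor hessian_exp_coord // E scal_hyp_mx ricci_hyp_mx.
by rewrite /iso_tensor hyp_mxE /=; ring.
Qed.

End HyperbolicProduct.

(** * Geodesics of a real hyperbolic space *)

Lemma is_derive_div (R : realType) (f g : R -> R) (df dg s : R) : g s != 0 ->
  is_derive s 1 f df -> is_derive s 1 g dg ->
  is_derive s 1 (fun t => f t / g t) ((df * g s - f s * dg) / g s ^+ 2).
Proof.
move=> gs Df Dg.
apply: is_derive_eq (is_deriveM Df (is_deriveV gs Dg)) _.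
by rewrite /GRing.scale /=; field.
Qed.

(** The geodesic equations of a factor of rate k. The height th has initial value
    t0 and velocity v0; the other coordinates are x_a + v_a h(s), where h(0) = 0
    and h'(0) = 1, and V is the sum of the squares of the v_a. Then y(s) =
    exp(k (th(s) - t0)) satisfies y'' = sg^2 y, where sg is k times the speed,
    and h' = 1/y^2. *)
Lemma hyperbolic_geodesic (R : realType) (k t0 v0 V : R) : 0 < k -> 0 <= V ->
  exists th dth h dh : R -> R,
  [/\ [/\ th 0 = t0, dth 0 = v0, h 0 = 0 & dh 0 = 1],
      forall s : R, is_derive s 1 th (dth s),
      forall s : R, is_derive s 1 dth (k * expR (2 * k * th s) * V * dh s ^+ 2),
      forall s : R, is_derive s 1 h (dh s) &
      forall s : R, is_derive s 1 dh (- 2 * k * dth s * dh s)].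
Proof.
move=> k0 V0; set E0 := expR (2 * k * t0).
have E0_gt0 : 0 < E0 by exact: expR_gt0.
(* The speed is zero: the geodesic is constant. *)
have [E_eq0|E_neq0] := eqVneq (v0 ^+ 2 + E0 * V) 0.
  have /eqP := E_eq0; rewrite paddr_eq0 ?sqr_ge0 ?mulr_ge0 ?(ltW E0_gt0) //.
  rewrite sqrf_eq0 mulf_eq0 (gt_eqF E0_gt0) /= => /andP[/eqP v00 /eqP V00].
  exists (cst t0), (cst 0), id, (cst 1).
  split=> [|s|s|s|s]; first by split; rewrite // v00.
  - exact: is_derive_cst.
  - by rewrite V00 mulr0 mul0r; exact: is_derive_cst.
  - exact: is_derive_id.
  - by rewrite mulr0 mul0r; exact: is_derive_cst.
have E_gt0 : 0 < v0 ^+ 2 + E0 * V.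
  by rewrite lt0r E_neq0 addr_ge0 ?sqr_ge0 ?mulr_ge0 ?(ltW E0_gt0).
pose sg := k * Num.sqrt (v0 ^+ 2 + E0 * V).
have sg_gt0 : 0 < sg by rewrite mulr_gt0 ?sqrtr_gt0.
have sg_neq0 : sg != 0 by rewrite gt_eqF.
have k_neq0 : k != 0 by rewrite gt_eqF.
have sg2 : sg ^+ 2 = k ^+ 2 * (v0 ^+ 2 + E0 * V).
  by rewrite exprMn sqr_sqrtr // ltW.
pose q := k * v0 / sg.
have q_le1 : -1 <= q <= 1.
  have q2 : q ^+ 2 <= 1.
    rewrite expr_div_n exprMn ler_pdivrMr ?exprn_gt0 // mul1r sg2.
    by rewrite ler_pM2l ?exprn_gt0 // lerDl mulr_ge0 // ltW.
  by apply/andP; split; nra.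
pose al := (1 + q) / 2; pose be := (1 - q) / 2.
pose y s := al * expR (sg * s) + be * expR (- sg * s).
pose dy s := sg * (al * expR (sg * s) - be * expR (- sg * s)).
(* z is the solution of z'' = sg^2 z such that z(0) = 0 and z'(0) = 1: the
   Wronskian z' y - z y' is 1, and h = z / y. *)
pose z s := (2 * sg)^-1 * expR (sg * s) + - (2 * sg)^-1 * expR (- sg * s).
have expK (s : R) : expR (- sg * s) * expR (sg * s) = 1.
  by rewrite -expRD mulNr addNr expR0.
have y_gt0 (s : R) : 0 < y s.
  have := expR_gt0 (sg * s); have := expR_gt0 (- sg * s).
  move: q_le1 => /andP[]; rewrite /y /al /be.
  by move: (expR _) (expR _) => a b q1 q2 b0 a0; nra.
have y_neq0 (s : R) : y s != 0 by rewrite gt_eqF.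
have Dy (s : R) : is_derive s 1 y (dy s).
  apply: is_derive_eq (is_deriveD (is_derive_expM al sg s) (is_derive_expM be (- sg) s)) _.
  by rewrite /dy; ring.
have Ddy (s : R) : is_derive s 1 dy (sg ^+ 2 * y s).
  rewrite (_ : dy = (fun s : R => (sg * al) * expR (sg * s)) + (fun s : R => (- sg * be) * expR (- sg * s))).
    apply: is_derive_eq (is_deriveD (is_derive_expM (sg * al) sg s)
      (is_derive_expM (- sg * be) (- sg) s)) _.
    by rewrite /y; ring.
  by apply/funext => t; rewrite !fctE /dy; ring.
have Dz (s : R) : is_derive s 1 z ((expR (sg * s) + expR (- sg * s)) / 2).
  apply: is_derive_eq (is_deriveD (is_derive_expM _ sg s) (is_derive_expM _ (- sg) s)) _.
  by field.
exists (fun s => t0 + k^-1 * ln (y s)), (fun s => k^-1 * (dy s / y s)),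
  (fun s => z s / y s), (fun s => (y s ^+ 2)^-1).
have y0 : y 0 = 1 by rewrite /y !mulr0 expR0 /al /be; field.
have Dlny (s : R) : is_derive s 1 (fun s => k^-1 * ln (y s)) (k^-1 * (dy s / y s)).
  apply: is_derive_eq (is_deriveZ k^-1 (is_derive1_comp (is_derive1_ln (y_gt0 s)) (Dy s))) _.
  by rewrite /GRing.scale /= [_^-1 * dy s]mulrC.
split.
- split.
  + by rewrite y0 ln1 mulr0 addr0.
  + by rewrite y0 /dy !mulr0 expR0 /al /be /q; field; rewrite sg_neq0.
  + by rewrite /z !mulr0 expR0 mulNr subrr mul0r.
  + by rewrite y0 expr1n invr1.
- move=> s; apply: is_derive_eq (is_deriveD (is_derive_cst t0 s 1) (Dlny s)) _.
  by rewrite add0r.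
- move=> s.
  apply: is_derive_eq (is_deriveZ k^-1 (is_derive_div (y_neq0 s) (Ddy s) (Dy s))) _.
  have -> : expR (2 * k * (t0 + k^-1 * ln (y s))) = E0 * y s ^+ 2.
    rewrite (_ : 2 * k * (t0 + k^-1 * ln (y s)) = 2 * k * t0 + (ln (y s) + ln (y s))).
      by rewrite 2!expRD lnK ?posrE // expr2.
    by field.
  (* Conservation of energy. *)
  have W : sg ^+ 2 * y s ^+ 2 - dy s ^+ 2 = k ^+ 2 * E0 * V.
    have -> : sg ^+ 2 * y s ^+ 2 - dy s ^+ 2 =
      4 * sg ^+ 2 * al * be * (expR (- sg * s) * expR (sg * s)).
      by rewrite /y /dy; ring.
    rewrite expK /al /be /q mulr1.
    rewrite (_ : k ^+ 2 * E0 * V = sg ^+ 2 - k ^+ 2 * v0 ^+ 2); last by rewrite sg2; ring.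
    by field.
  rewrite (_ : sg ^+ 2 * y s * y s - dy s * dy s = k ^+ 2 * E0 * V);
    last by rewrite -W; ring.
  rewrite /GRing.scale /=.
  by field; rewrite k_neq0 y_neq0.
- move=> s; apply: is_derive_eq (is_derive_div (y_neq0 s) (Dz s) (Dy s)) _.
  rewrite (_ : _ - _ = 1) ?div1r // -[RHS](expK s).
  by rewrite /y /z /dy /al /be; field.
- move=> s.
  have Dy2 : is_derive s 1 (fun s => y s ^+ 2) (2 * y s * dy s).
    by apply: is_derive_eq (is_deriveM (Dy s) (Dy s)) _; rewrite /GRing.scale /=; ring.
  have y2 : y s ^+ 2 != 0 by rewrite expf_neq0.
  apply: is_derive_eq (@is_deriveV _ (fun s => y s ^+ 2) _ _ _ y2 Dy2) _.
  by rewrite /GRing.scale /=; field; rewrite k_neq0 y_neq0.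
Qed.

(** * The manifold, its completeness *)

(** The manifold R^n with the identity as only chart. *)
Definition euclidean_space (R : realType) (n : nat) : smoothManifold R n.
Proof.
refine (@SmoothManifold R n 'rV[R]_n (@norm_hausdorff _ _)
  (@second_countable_rV R n) (@connected_rV R n) unit
  (fun=> setT) (fun=> setT) (fun=> id) (fun=> id) _ _ _ _ _ _ _ _ _ _).
- by move=> _; exact: openT.
- by move=> _; exact: openT.
- by move=> p; exists tt.
- by [].
- by [].
- by [].
- by [].
- by move=> _ p _; exact: cvg_id.
- by move=> _ p _; exact: cvg_id.
- by move=> _ _ k; exact: smooth_coord.
Defined.

Section HyperbolicProductSpace.
Context {R : realType} {n : nat}.
Context (par : 'I_n -> 'I_n) (rate : 'I_n -> R).
Context (par_idem : forall j, par (par j) = par j).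

Let M := euclidean_space R n.

Lemma hyp_mx_smooth (i : chart_index M) (a b : 'I_n) :
  smooth_on (cod i) (fun x => hyp_mx par rate x a b).
Proof. by rewrite hyp_mxE_exp; exact: smooth_exp_coord. Qed.

Lemma hyp_mx_sym (i : chart_index M) x :
  cod i x -> (hyp_mx par rate x)^T = hyp_mx par rate x.
Proof. by rewrite /hyp_mx tr_diag_mx. Qed.

Lemma hyp_mx_pos (i : chart_index M) x : cod i x ->
  forall v : 'rV[R]_n, v != 0 -> 0 < (v *m hyp_mx par rate x *m v^T) 0 0.
Proof.
move=> _ v v0; rewrite mxE.
under eq_bigr do rewrite mul_mx_diag !mxE mulrAC -expr2.
have [k vk] : exists k, v 0 k != 0.
  apply/existsP; move: v0; apply: contraNT; rewrite negb_exists => /forallP H.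
  apply/eqP/rowP => k; rewrite mxE; apply/eqP; move: (H k); by rewrite negbK.
rewrite (bigD1 k) //= ltr_pwDl //.
  by rewrite mulr_gt0 ?sqlen_gt0 // lt0r sqr_ge0 sqrf_eq0 vk.
by apply: sumr_ge0 => j _; rewrite mulr_ge0 ?sqr_ge0 // ltW ?sqlen_gt0.
Qed.

Lemma hyp_mx_compat (i j : chart_index M) x : cod i x -> dom j (param i x) ->
  hyp_mx par rate x = transition_jac i j x *m hyp_mx par rate (chart j (param i x))
    *m (transition_jac i j x)^T.
Proof.
move=> _ _; have -> : transition_jac i j x = 1%:M.
  by apply/matrixP => a c; rewrite !mxE; exact: partial_coord.
by rewrite trmx1 mulmx1 mul1mx.
Qed.

(** The product of hyperbolic metrics on R^n. *)
Definition hyp_metric : riemannianMetric M :=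
  @RiemannianMetric R n M (fun=> hyp_mx par rate)
    hyp_mx_smooth hyp_mx_sym hyp_mx_pos hyp_mx_compat.

(** The quadratic term of the geodesic equation for a velocity u. *)
Lemma sum_christoffel_quadratic (u : 'I_n -> R) k x :
  \sum_a \sum_b christoffel (hyp_mx par rate) k a b x * u a * u b =
  2 * weight par rate k * u (par k) * u k
  - \sum_a slope par rate k a * sqlen par rate a x * u a ^+ 2.
Proof.
transitivity (\sum_a (slope par rate a k * (u k * u a)
    + (k == a)%:R * (weight par rate a * u (par a) * u a)
    - slope par rate k a * sqlen par rate a x * u a ^+ 2)).
  apply: eq_bigr => a _.
  transitivity (u a * \sum_b christoffel (hyp_mx par rate) k a b x * u b).
    by rewrite mulr_sumr; apply: eq_bigr => b _; ring.
  by rewrite sum_christoffel // eq_sym; ring.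
by rewrite sumrB big_split /= sum_slope sum_kron; ring.
Qed.

Lemma hyp_metric_complete : (forall j, 0 < rate j) -> complete_metric hyp_metric.
Proof.
move=> rate_gt0 [] p v _.
(* Squared coordinate norm of the part of v tangent to the horospheres of the
   factor of root r. *)
pose V r := \sum_a (par a == r)%:R * (par a != a)%:R * v 0 a ^+ 2.
have V_ge0 r : 0 <= V r.
  by apply: sumr_ge0 => a _; rewrite mulr_ge0 ?sqr_ge0 // mulr_ge0 ?ler0n.
have /choice[th /choice[dth /choice[h /choice[dh H]]]] :=
  fun r => hyperbolic_geodesic (p 0 r) (v 0 r) (rate_gt0 r) (V_ge0 r).
pose u k (s : R) : R := if par k == k then th k s else p 0 k + v 0 k * h (par k) s.
pose du k (s : R) : R := if par k == k then dth k s else v 0 k * dh (par k) s.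
pose ddu k (s : R) : R := if par k == k
  then rate k * expR (2 * rate k * th k s) * V k * dh k s ^+ 2
  else v 0 k * (- 2 * rate (par k) * dth (par k) s * dh (par k) s).
have Du k (s : R) : is_derive s 1 (u k) (du k s).
  rewrite /u /du; case: (par k == k); first by have [] := H k.
  have [_ _ _ D _] := H (par k).
  apply: is_derive_eq (is_deriveD (is_derive_cst (p 0 k) s 1) (is_deriveZ (v 0 k) (D s))) _.
  by rewrite add0r.
have Ddu k (s : R) : is_derive s 1 (du k) (ddu k s).
  rewrite /du /ddu; case: (par k == k); first by have [] := H k.
  have [_ _ _ _ D] := H (par k).
  exact: is_deriveZ.
have du1 k : derive1 (u k) = du k.
  by apply/funext => s; rewrite derive1E; have [] := Du k s.
have uE k : (fun t : R => (\row_j u j t) 0 k) = u k.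
  by apply/funext => t; rewrite mxE.
exists (fun t => \row_k u k t); split.
- split.
    move=> t; apply: differentiable_continuous; apply/derivable1_diffP.
    apply/derivable_mxP => i k; rewrite ord1 uE.
    by have [] := Du k t.
  move=> [] t _ /= k; rewrite uE du1; split.
  + by have [] := Du k t.
  + by have [] := Ddu k t.
  + have -> : \sum_a \sum_b christoffel (hyp_mx par rate) k a b (\row_k0 u k0 t) *
        derive1 (fun t' : R => (\row_k0 u k0 t') 0 a) t *
        derive1 (fun t' : R => (\row_k0 u k0 t') 0 b) t =
      \sum_a \sum_b christoffel (hyp_mx par rate) k a b (\row_k0 u k0 t) *
        du a t * du b t.
      by apply: eq_bigr => a _; apply: eq_bigr => b _; rewrite !uE !du1.
    rewrite (sum_christoffel_quadratic (du^~ t)).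
    have -> : derive1 (du k) t = ddu k t by rewrite derive1E; have [] := Ddu k t.
    (* For a root k, w_k = 0 and the sum over a is the term in V. For the other
       coordinates, the sum over a is zero. *)
    rewrite /ddu /weight; have [pk|pk] := eqVneq (par k) k.
      rewrite mulr0 !mul0r sub0r; apply/eqP; rewrite subr_eq0; apply/eqP.
      rewrite /V mulr_sumr mulr_suml; apply: eq_bigr => a _.
      rewrite /slope [k == _]eq_sym; have [pa|_] := eqVneq (par a) k; last by rewrite /=; ring.
      rewrite /du /weight /sqlen /exp_coord pa.
      have [->|ka] := eqVneq k a; first by rewrite /=; ring.
      by rewrite /weight pa (negbTE ka) mxE /u pk eqxx /=; ring.
    rewrite big1 => [|a _].
      by rewrite /du par_idem eqxx (negbTE pk); ring.
    rewrite /slope; case: eqP => [ka|_]; last by rewrite !mul0r.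
    by move: pk; rewrite ka par_idem eqxx.
- apply/rowP => k; rewrite mxE /u; case: eqP => _; first by have [[]] := H k.
  by have [[_ _ -> _] _ _ _ _] := H (par k); rewrite mulr0 addr0.
- move=> k /=; rewrite uE du1 /du; case: eqP => _; first by have [[]] := H k.
  by have [[_ _ _ ->] _ _ _ _] := H (par k); rewrite mulr1.
Qed.

End HyperbolicProductSpace.

(** * The example *)

Theorem proposition2p5 (R : realType) (n : nat) (hn : (4 <= n)%N) :
  exists (M : smoothManifold R n) (g : riemannianMetric M) (f : M -> R),
    [/\ vacuum_static_space g f,
        vanishes (fun i => tdiv (g i) (tdiv (g i) (bach (g i)))),
        vanishes (fun i => div4_weyl (g i)) &
        ~ vanishes (fun i => bach (g i))].
Proof.
case: n hn => [|[|[|[|m]]]] // _.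
(* The coordinates 0 and 1 belong to H^2, of root o, the other ones to H^(m+2),
   of root o2. *)
pose o : 'I_m.+4 := inord 0; pose o2 : 'I_m.+4 := inord 2.
pose par (i : 'I_m.+4) := if (i < 2)%N then o else o2.
have o_val : val o = 0%N by rewrite /o /= inordK.
have o2_val : val o2 = 2%N by rewrite /o2 /= inordK.
have par_o : par o = o by rewrite /par o_val.
have par_o2 : par o2 = o2 by rewrite /par o2_val.
have par_idem i : par (par i) = par i.
  by rewrite {2 3}/par; case: ifP.
have o_o2 : o2 == o = false by apply/eqP => /(congr1 val); rewrite o_val o2_val.
pose rate (i : 'I_m.+4) : R := if i == o then 1 else Num.sqrt (2 / m.+1%:R).
have rate_o : rate o = 1 by rewrite /rate eqxx.
have rate_o2 : rate o2 ^+ 2 = 2 / m.+1%:R by rewrite /rate o_o2 sqr_sqrtr.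
have rate_gt0 i : 0 < rate i by rewrite /rate; case: eqP => // _; rewrite sqrtr_gt0.
(* The two factors have dimensions 2 and m + 2. *)
have sum_par (F : 'I_m.+4 -> R) : \sum_a F (par a) = 2 * F o + m.+2%:R * F o2.
  rewrite !big_ord_recl /par /=.
  by rewrite sumr_const card_ord; ring.
have sect_o i : sect par rate o i = (par i == o)%:R.
  by rewrite /sect par_o rate_o expr1n mulr1 eq_sym.
have sect_o2 i : sect par rate o2 i = (par i == o2)%:R * (2 / m.+1%:R).
  by rewrite /sect par_o2 rate_o2 eq_sym.
have ric_o : ric_coef par rate o = -1.
  rewrite /ric_coef par_o rate_o; under eq_bigr do rewrite sect_o.
  by rewrite (sum_par (fun i => (i == o)%:R)) eqxx o_o2 /=; ring.
have m2 : m%:R + 2 != 0 :> R by rewrite -natrD pnatr_eq0 addn2.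
have m3 : m%:R + 3 != 0 :> R by rewrite -natrD pnatr_eq0 addn3.
have n1E : m.+4%:R - 1 = m%:R + 3 :> R by rewrite -addn4 natrD; ring.
have n2E : m.+4%:R - 2 = m%:R + 2 :> R by rewrite -addn4 natrD; ring.
have ric_o2 : ric_coef par rate o2 = -2.
  rewrite /ric_coef par_o2 rate_o2; under eq_bigr do rewrite sect_o2.
  rewrite (sum_par (fun i => (i == o2)%:R * _)) eqxx eq_sym o_o2 /=.
  by rewrite -addn2 -addn1 !natrD; field; rewrite addrC natr1.
have ricE i : ric_coef par rate i = ric_coef par rate (par i).
  by apply: ric_coef_par; rewrite par_idem.
have S_E : \sum_a ric_coef par rate a = - 2 * (m%:R + 3).
  under eq_bigr do rewrite ricE.
  by rewrite (sum_par (ric_coef par rate)) ric_o ric_o2 -addn2 natrD; ring.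
have weyl_oo : weyl_coef par rate o o = -1.
  rewrite /weyl_coef sect_o par_o eqxx ric_o S_E n1E n2E /=; field.
  by rewrite m2 m3.
have weyl_oo2 : weyl_coef par rate o o2 = (m%:R + 2)^-1.
  rewrite /weyl_coef sect_o par_o2 o_o2 ric_o ric_o2 S_E n1E n2E /=; field.
  by rewrite m2 m3.
have weyl_ric_o : weyl_ric_coef par rate o = -1.
  rewrite /weyl_ric_coef.
  have weylE a : weyl_coef par rate o a = weyl_coef par rate o (par a).
    by rewrite /weyl_coef !sect_o par_idem -ricE.
  under eq_bigr do rewrite ricE weylE.
  rewrite (sum_par (fun a => ric_coef par rate a * weyl_coef par rate o a)).
  rewrite weyl_oo weyl_oo2 ric_o ric_o2 -addn2 natrD; field.
  exact: m2.
exists (euclidean_space R m.+4), (hyp_metric par rate), (exp_coord 1 (rate o) o).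
split.
- split.
  + exact: hyp_metric_complete.
  + by move=> i; exact: smooth_exp_coord.
  + exists 0, (delta_mx 0 o) => /eqP.
    rewrite /exp_coord !mxE !eqxx mulr0 mulr1 !mul1r rate_o (inj_eq (@expR_inj R)).
    by rewrite eq_sym oner_eq0.
  + move=> i x s _; apply: static_exp_coord => // j.
    rewrite rate_o S_E n1E ricE.
    have [|] : par j = o \/ par j = o2 by rewrite /par; case: ifP; [left|right].
      by move=> ->; rewrite eqxx ric_o /=; field.
    by move=> ->; rewrite o_o2 ric_o2 /=; field.
- by move=> i x s _; rewrite /= tdiv2_bach.
- by move=> i x s _; rewrite /= div4_weyl_hyp_mx.
- move=> /(_ tt 0 [tuple o; o] I) /eqP; apply/negP.
  apply: bach_diag_neq0 => //.
  by rewrite weyl_ric_o oppr_eq0 oner_eq0.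
Qed.
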